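(* Let $G_1$ and $G_2$ be graphs with disjoint vertex sets. If $G_1$ is complete, then $\mathrm{thin}(G_1\vee G_2)=\mathrm{thin}(G_2)$. If neither $G_1$ nor $G_2$ is complete, then $\mathrm{thin}(G_1\vee G_2)=\mathrm{thin}(G_1)+\mathrm{thin}(G_2)$.
   Context: Graphs are finite, simple, undirected. The join $G_1\vee G_2$ has vertex set $V_1\cup V_2$ and edge set $E_1\cup E_2\cup\{vv': v\in V_1, v'\in V_2\}$. For a graph $G=(V,E)$, an ordering $v_1,\dots,v_n$ of $V$ and a partition of $V$ are consistent if for every $r<s<t$, whenever $v_r,v_s$ are in the same class and $v_tv_r\in E$, then $v_tv_s\in E$. $\mathrm{thin}(G)$ is the minimum number of classes of a partition of $V$ consistent with some ordering of $V$. *)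

(* Defs.v *)
From mathcomp Require Import all_boot.

Set Implicit Arguments.
Unset Strict Implicit.
Unset Printing Implicit Defensive.

(* The vertex type may be empty; the empty graph has thinness 0, so
   thin (K_1 \/ G) = thin G fails when G is empty. *)
Record sgraph := SGraph {
  vertex :> finType;
  edge : rel vertex;
  edge_sym : symmetric edge;
  edge_irrefl : irreflexive edge
}.

Definition complete (G : sgraph) : Prop :=
  forall x y : G, x != y -> edge x y.

Section Join.
Variables G1 G2 : sgraph.

Definition join_edge : rel (G1 + G2)%type := fun u v =>
  match u, v with
  | inl x, inl y => edge x y
  | inr x, inr y => edge x y
  | _, _ => true
  end.

Lemma join_edge_sym : symmetric join_edge.
Proof. by case=> x [] y //=; apply: edge_sym. Qed.

Lemma join_edge_irrefl : irreflexive join_edge.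
Proof. by case=> x /=; apply: edge_irrefl. Qed.

(* The disjoint type sum plays the role of the union of two disjoint vertex
   sets. *)
Definition join : sgraph := SGraph join_edge_sym join_edge_irrefl.
End Join.

Section Thinness.
Variable G : sgraph.

(* A vertex ordering is a duplicate-free tuple of length #|G|; it therefore
   lists every vertex exactly once. *)
Definition consistent (v : #|G|.-tuple G) (P : {set {set G}}) : bool :=
  [forall r : 'I_#|G|, forall s : 'I_#|G|, forall t : 'I_#|G|,
    [&& r < s, s < t,
        [exists B in P, (tnth v r \in B) && (tnth v s \in B)]
      & edge (tnth v t) (tnth v r)]
    ==> edge (tnth v t) (tnth v s)].

Definition has_thin_partition (k : nat) : bool :=
  [exists v : #|G|.-tuple G, exists P : {set {set G}},
    [&& uniq v, partition P [set: G], consistent v P & #|P| == k]].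

Lemma ex_thin_partition : exists k, has_thin_partition k.
Proof.
pose P := preim_partition id [set: G].
have partP : partition P [set: G] by apply: preim_partitionP.
exists #|P|; apply/existsP; exists (enum_tuple G).
apply/existsP; exists P; apply/and4P; split=> //; first exact: enum_uniq.
apply/'forall_'forall_'forall_implyP=> r s t /and4P[_ _].
case/exists_inP=> B BP /andP[rB sB]; congr (is_true (edge _ _)).
have /and3P[_ tiP _] := partP.
have : tnth (enum_tuple G) s \in pblock P (tnth (enum_tuple G) r).
  by rewrite (def_pblock tiP BP rB).
by rewrite pblock_equivalence_partition ?inE // => [/eqP|]; last by split=> // /eqP->.
Qed.

Definition thin : nat := ex_minn ex_thin_partition.
End Thinness.

(* Main.v *)
Require Import Defs.
From mathcomp Require Import all_boot.

(** For the lower bound in the non-complete case, fix an ordering of a graph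
    and call a vertex forward dominating when it is adjacent to every later
    vertex. The forward dominating vertices can all be moved to the end of the
    ordering and then assigned to arbitrary classes without breaking
    consistency, so the thinness of a non-complete graph is bounded by the
    number of classes containing a vertex that is not forward dominating. In a
    consistent ordering of [join G1 G2], a class cannot contain such a vertex
    of [G1] and such a vertex of [G2]: the later of the two would be adjacent
    to all later vertices of its own graph, because the earlier one is. Hence
    the classes counted for [G1] and for [G2] are disjoint. *)

Set Implicit Arguments.
Unset Strict Implicit.
Unset Printing Implicit Defensive.

(* Orderings are encoded by injective ranks and partitions by colourings. *)
Definition consistent_coloring (G : sgraph) (C : eqType)
    (f : G -> nat) (c : G -> C) : Prop :=
  forall x y z, f x < f y -> f y < f z -> c x = c y -> edge z x -> edge z y.

(** Sorting the vertices by rank gives the ordering, and the fibres of [c] give the partition. *)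
Lemma thin_le_coloring (G : sgraph) (C : finType) (f : G -> nat) (c : G -> C) :
  injective f -> consistent_coloring f c -> thin G <= #|c @: [set: G]|.
Proof.
move=> injf consf; pose leT := [rel x y | f x <= f y].
have leT_tr : transitive leT by move=> y x z /=; apply: leq_trans.
have leT_total : total leT by move=> x y /=; apply: leq_total.
have sz : size (sort leT (enum G)) == #|G| by rewrite size_sort cardE.
pose v := Tuple sz.
have uniqv : uniq v by rewrite /= sort_uniq enum_uniq.
have f_mono (r s : 'I_#|G|) : r < s -> f (tnth v r) < f (tnth v s).
  move=> rs; rewrite ltn_neqAle; apply/andP; split.
    apply/eqP=> /injf /eqP.
    rewrite (tnth_nth (tnth v r)) (tnth_nth (tnth v r) v s).
    by rewrite nth_uniq ?size_tuple // (ltn_eqF rs).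
  rewrite (tnth_nth (tnth v r)) (tnth_nth (tnth v r) v s).
  apply: (sorted_ltn_nth leT_tr) rs; rewrite ?inE ?size_tuple //.
  exact: sort_sorted.
pose P := preim_partition c [set: G].
have partP : partition P [set: G] by apply: preim_partitionP.
apply: (@leq_trans #|P|); last first.
  (* Every block is the fibre of an attained colour, so there are at most as many blocks as attained
     colours. *)
  apply: leq_trans (leq_imset_card (fun i => [set y | i == c y]) _).
  apply/subset_leq_card/subsetP=> B /imsetP[x _ ->].
  apply/imsetP; exists (c x); first exact: imset_f.
  by apply/setP=> y; rewrite !inE.
rewrite /thin; case: ex_minnP => m _; apply.
apply/existsP; exists v; apply/existsP; exists P.
apply/and4P; split=> //.
apply/'forall_'forall_'forall_implyP=> r s t /and4P[rs st].
case/exists_inP=> B /imsetP[x _ ->]; rewrite !inE /=.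
by case/andP=> /eqP cr /eqP cs; apply: consf; rewrite ?f_mono // -cr.
Qed.

(** Ranks are positions in an optimal ordering and colours are blocks. The bound on ranks lets
    further vertices be placed after those of [G]. *)
Lemma thin_coloring (G : sgraph) :
  exists (f : G -> nat) (c : G -> {set G}),
    [/\ injective f, forall x, f x < #|G|, consistent_coloring f c
      & #|c @: [set: G]| <= thin G].
Proof.
rewrite /thin; case: ex_minnP => m /existsP[v /existsP[P]] /and4P[].
move=> uniqv partP consP /eqP<- _.
have mem_v x : x \in v.
  have sub_v : {subset v <= enum G} by move=> y; rewrite mem_enum.
  have sz_v : size (enum G) <= size v by rewrite size_tuple cardE.
  by rewrite (uniq_min_size uniqv sub_v sz_v) mem_enum.
have idx_lt x : index x v < #|G| by have := mem_v x; rewrite -index_mem size_tuple.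
have tnthK x : tnth v (Ordinal (idx_lt x)) = x.
  by rewrite (tnth_nth x) /= nth_index.
case/and3P: (partP) => /eqP coverP tiP _.
have in_cover x : x \in cover P by rewrite coverP inE.
exists (index^~ v), (pblock P); split=> //.
- by move=> x y exy; rewrite -(tnthK x) -(tnthK y); congr tnth; apply/val_inj.
- move=> x y z xy yz cxy zx.
  have /forallP/(_ (Ordinal (idx_lt x))) := consP.
  move=> /forallP/(_ (Ordinal (idx_lt y)))/forallP/(_ (Ordinal (idx_lt z))).
  rewrite !tnthK => /implyP; apply; apply/and4P; split=> //.
  apply/exists_inP; exists (pblock P x); first exact: pblock_mem.
  by rewrite {2}cxy !mem_pblock !in_cover.
- by apply/subset_leq_card/subsetP=> B /imsetP[x _ ->]; apply: pblock_mem.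
Qed.

(** An optimal ordering and partition of the join restrict to its induced subgraph [G2]. *)
Lemma thin_joinr (G1 G2 : sgraph) : thin G2 <= thin (join G1 G2).
Proof.
have [f [c [injf _ consf le_c]]] := thin_coloring (join G1 G2).
apply: leq_trans le_c.
apply: leq_trans (thin_le_coloring (f := f \o inr) (c := c \o inr) _ _) _.
- by move=> x y /injf[].
- by move=> x y z; apply: (consf (inr x) (inr y) (inr z)).
- apply/subset_leq_card/subsetP=> B /imsetP[x _ ->].
  exact: imset_f.
Qed.

(** The vertices of [G1] are adjacent to all others in the join, so they can be placed last and put
    into an existing class, that of some [y0] in [G2]. *)
Lemma thin_join_complete (G1 G2 : sgraph) :
  0 < #|G2| -> complete G1 -> thin (join G1 G2) <= thin G2.
Proof.
move=> /card_gt0P[y0 _] G1c.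
have [f [c [injf f_lt consf le_c]]] := thin_coloring G2.
pose f' (u : join G1 G2) :=
  match u with inl x => #|G2| + enum_rank x | inr y => f y end.
pose c' (u : join G1 G2) := match u with inl _ => c y0 | inr y => c y end.
have lt_f' x y : f' (inr y) < f' (inl x) by rewrite /= ltn_addr.
apply: leq_trans le_c.
apply: leq_trans (thin_le_coloring (f := f') (c := c') _ _) _.
- move=> [x|x] [y|y] e.
  + by congr inl; apply/enum_rank_inj/val_inj/(addnI e).
  + by have := lt_f' x y; rewrite e ltnn.
  + by have := lt_f' y x; rewrite e ltnn.
  + by congr inr; apply: injf.
- move=> [x|x] [y|y] [z|z] // xy yz e.
  + by move=> _; apply: G1c; apply: contraTneq yz => ->; rewrite ltnn.
  + by have := ltn_trans xy (lt_f' x y); rewrite ltnn.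
  + by move=> _; apply: G1c; apply: contraTneq yz => ->; rewrite ltnn.
  + exact: consf e.
- apply/subset_leq_card/subsetP=> B /imsetP[[x|x] _ ->]; exact: imset_f.
Qed.

(** With disjoint palettes, two vertices of the same colour lie on the same side, and a third vertex
    on the other side is adjacent to both. *)
Lemma thin_join_le (G1 G2 : sgraph) : thin (join G1 G2) <= thin G1 + thin G2.
Proof.
have [f1 [c1 [injf1 f1_lt cons1 le_c1]]] := thin_coloring G1.
have [f2 [c2 [injf2 _ cons2 le_c2]]] := thin_coloring G2.
pose f (u : join G1 G2) :=
  match u with inl x => f1 x | inr y => #|G1| + f2 y end.
pose c (u : join G1 G2) : ({set G1} + {set G2})%type :=
  match u with inl x => inl (c1 x) | inr y => inr (c2 y) end.
have lt_f x y : f (inl x) < f (inr y) by rewrite /= ltn_addr.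
apply: leq_trans (leq_add le_c1 le_c2).
apply: leq_trans (thin_le_coloring (f := f) (c := c) _ _) _.
- move=> [x|x] [y|y] e.
  + by congr inl; apply: injf1.
  + by have := lt_f x y; rewrite e ltnn.
  + by have := lt_f y x; rewrite e ltnn.
  + by congr inr; apply/injf2/(addnI e).
- move=> [x|x] [y|y] [z|z] //= xy yz [e].
  + exact: cons1 e.
  + by rewrite !ltn_add2l in xy yz; apply: cons2 e.
- rewrite -(card_imset _ (@inl_inj {set G1} {set G2})).
  rewrite -(card_imset _ (@inr_inj {set G1} {set G2})).
  apply: leq_trans (leq_card_setU _ _).
  apply/subset_leq_card/subsetP=> B /imsetP[[x|x] _ ->]; rewrite inE; apply/orP.
    by left; do 2!apply: imset_f.
  by right; do 2!apply: imset_f.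
Qed.

Definition forward_dominating (G : sgraph) (f : G -> nat) (x : G) : bool :=
  [forall z, (f x < f z) ==> edge z x].

Lemma not_complete_dominating (G : sgraph) (f : G -> nat) :
  injective f -> ~ complete G -> exists x, ~~ forward_dominating f x.
Proof.
move=> injf ncG; apply/existsP; apply: contra_notT ncG.
rewrite negb_exists => /forallP dom x y xy.
have {}dom u w : f u < f w -> edge w u.
  by have := dom u; rewrite negbK => /forallP/(_ w)/implyP.
have [/dom|/dom|/injf e] := ltngtP (f x) (f y); last by rewrite e eqxx in xy.
  by rewrite edge_sym.
by [].
Qed.

Lemma thin_le_nondominating (G : sgraph) (C : finType)
    (f : G -> nat) (c : G -> C) :
  injective f -> consistent_coloring f c -> ~ complete G ->
  thin G <= #|c @: [set x | ~~ forward_dominating f x]|.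
Proof.
move=> injf consf /(not_complete_dominating injf)[x0 x0P].
have domP u w : forward_dominating f u -> f u < f w -> edge w u.
  by move=> /forallP/(_ w)/implyP.
pose N := (\max_x f x).+1.
have f_lt x : f x < N by rewrite ltnS leq_bigmax.
(* The shift by [N] exceeds every rank and keeps the relative order of the moved vertices. They take
   the colour of [x0], which is among those counted because [x0] is not forward dominating. *)
pose f' x := if forward_dominating f x then N + f x else f x.
pose c' x := if forward_dominating f x then c x0 else c x.
apply: leq_trans (thin_le_coloring (f := f') (c := c') _ _) _.
- move=> x y; rewrite /f'; case: ifP => _; case: ifP => _.
  + by move/addnI/injf.
  + by move=> e; have := f_lt y; rewrite -e ltnNge leq_addr.
  + by move=> e; have := f_lt x; rewrite e ltnNge leq_addr.
  + exact: injf.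
- move=> x y z; rewrite /f' /c'.
  (* After a moved [y] come only moved vertices that already followed it under [f], and [y]
     dominates these. *)
  case dy: (forward_dominating f y).
    move=> _; case: ifP => _ yz _ _; first by rewrite ltn_add2l in yz; apply: domP.
    by have := ltn_trans yz (f_lt z); rewrite ltnNge leq_addr.
  case: ifP => _ xy.
    by have := ltn_trans xy (f_lt y); rewrite ltnNge leq_addr.
  case dz: (forward_dominating f z) => yz; last exact: consf.
  (* Here only [z] may have overtaken [y]; if it did, [z] itself dominates [y]. *)
  have [zy|yz'|/injf e] := ltngtP (f z) (f y).
  + by move=> _ _; rewrite edge_sym; apply: domP.
  + exact: consf.
  + by rewrite e dy in dz.
- apply/subset_leq_card/subsetP=> i /imsetP[x _ ->]; rewrite /c'.
  by case: ifPn => dx; apply: imset_f; rewrite inE.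
Qed.

Lemma thin_join_ge (G1 G2 : sgraph) :
  ~ complete G1 -> ~ complete G2 -> thin G1 + thin G2 <= thin (join G1 G2).
Proof.
move=> nc1 nc2; have [f [c [injf _ consf le_c]]] := thin_coloring (join G1 G2).
apply: leq_trans le_c.
pose f1 (x : G1) := f (inl x); pose c1 (x : G1) := c (inl x).
pose f2 (x : G2) := f (inr x); pose c2 (x : G2) := c (inr x).
have injf1 : injective f1 by move=> x y /injf[].
have injf2 : injective f2 by move=> x y /injf[].
have cons1 : consistent_coloring f1 c1.
  by move=> x y z; apply: (consf (inl x) (inl y) (inl z)).
have cons2 : consistent_coloring f2 c2.
  by move=> x y z; apply: (consf (inr x) (inr y) (inr z)).
apply: leq_trans (leq_add (thin_le_nondominating injf1 cons1 nc1)
                          (thin_le_nondominating injf2 cons2 nc2)) _.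
set A := c1 @: _; set B := c2 @: _.
have AB0 : A :&: B = set0.
  apply/setP=> i; rewrite !inE; apply/negP=> /andP[/imsetP[x dx ->]].
  case/imsetP=> y dy cxy; rewrite !inE in dx dy.
  have [xy|yx|/injf//] := ltngtP (f (inl x)) (f (inr y)).
  + case/negP: dy; apply/forallP=> z; apply/implyP=> yz.
    (* The required edge from [z] to [x] is a cross edge of the join, true by computation. *)
    exact: (consf (inl x) (inr y) (inr z)).
  + case/negP: dx; apply/forallP=> z; apply/implyP=> xz.
    exact: (consf (inr y) (inl x) (inl z)).
rewrite -cardsUI AB0 cards0 addn0.
apply/subset_leq_card/subsetP=> i; rewrite inE.
by case/orP=> /imsetP[x _ ->]; apply: imset_f.
Qed.

Theorem theorem4p6 (G1 G2 : sgraph) :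
  (0 < #|G2| -> complete G1 -> thin (join G1 G2) = thin G2) /\
  (~ complete G1 -> ~ complete G2 ->
   thin (join G1 G2) = thin G1 + thin G2).
Proof.
split=> [G2_gt0 G1c|nc1 nc2]; apply/eqP; rewrite eqn_leq.
  by rewrite thin_join_complete // thin_joinr.
by rewrite thin_join_le thin_join_ge.
Qed.
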